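(* Let $q$ be a power of $2$ and $a,b\in\mathbb{N}$. If $\lfloor a/q\rfloor$ is even, then $t^{2q^2}[a,b]=[a+q,b]$. If $\lfloor b/q\rfloor$ is even, then $t^{4q^2}[a,b]=[a,b+q]$.
   Context: $\mathbb{N}=\{0,1,2,\dots\}$. Let $g:\mathbb{N}\to\mathbb{N}$ be defined by $g(0)=0$, $g(2n)=4g(n)$, $g(2n+1)=g(2n)+1$. For $a,b\in\mathbb{N}$, $[a,b]$ denotes the monomial $t^{1+2g(a)+4g(b)}\in\mathbb{Z}/2[t]$. *)

(* Defs.v *)
From mathcomp Require Import all_boot all_algebra.

Set Implicit Arguments.
Unset Strict Implicit.
Unset Printing Implicit Defensive.

Import GRing.Theory.

(* The recursion on n./2 is not structural: k is fuel, and n units suffice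
   for n. The defining equations of g are g0, g_double and g_doubleS below. *)
Fixpoint g_rec (k n : nat) : nat :=
  if k is k'.+1 then 4 * g_rec k' n./2 + odd n else 0.

Definition g (n : nat) : nat := g_rec n n.

Lemma g_recE k n : n <= k -> g_rec k n = g n.
Proof.
suff H m : forall k1 k2, m <= k1 -> m <= k2 -> g_rec k1 m = g_rec k2 m.
  by move=> le_nk; apply: H.
have half0 : forall j, g_rec j 0 = 0 by elim=> //= j ->.
have [N] := ubnP m; elim: N m => // N IH [|m] ltmN k1 k2; first by rewrite !half0.
case: k1 => // k1; case: k2 => // k2; rewrite !ltnS => le1 le2 /=.
have leu : uphalf m <= m by rewrite leq_uphalf_double -addnn leq_addr.
congr (4 * _ + _); apply: IH; first exact: leq_ltn_trans leu _.
- exact: leq_trans leu le1.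
- exact: leq_trans leu le2.
Qed.

Lemma g0 : g 0 = 0.
Proof. by []. Qed.

Lemma gE n : g n = 4 * g n./2 + odd n.
Proof.
case: n => // n; rewrite {1}/g /=.
by rewrite g_recE // leq_uphalf_double -addnn leq_addr.
Qed.

Lemma g_double n : g (2 * n) = 4 * g n.
Proof. by rewrite gE mul2n odd_double doubleK addn0. Qed.

Lemma g_doubleS n : g (2 * n + 1) = g (2 * n) + 1.
Proof. by rewrite g_double gE addn1 mul2n /= odd_double uphalf_double. Qed.

(* The monomial [a, b]. *)
Definition brmon (a b : nat) : {poly 'F_2} := ('X^(1 + 2 * g a + 4 * g b)%N)%R.

(* Main.v *)
Require Import Defs.
From mathcomp Require Import all_boot all_algebra.
From mathcomp Require Import zify.
Import GRing.Theory.
Local Open Scope ring_scope.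

(** Evenness of [a %/ q] with [q = 2 ^ k] says that binary digit [k] of [a] is 0, so adding [q] only
    sets that digit and [g a] grows by [q ^ 2]. The exponent of [brmon a b] weights [g a] by 2 and
    [g b] by 4, hence the factors [2 * q ^ 2] and [4 * q ^ 2]. *)

(* [g] reads the binary digits of its argument in base 4, so adding [2 ^ k]
   without a carry adds [4 ^ k] to the value. *)
Lemma g_addn_expn2 (k a : nat) :
  ~~ odd (a %/ 2 ^ k)%N -> g (a + 2 ^ k)%N = (g a + (2 ^ k) ^ 2)%N.
Proof.
elim: k a => [|k IH] a.
  rewrite divn1 addn1 => even_a.
  by rewrite gE (gE a) /= uphalf_half (negbTE even_a) !add0n addn0.
(* Dropping the lowest digit turns digit [k.+1] of [a] into digit [k] of [a./2], so the induction
   hypothesis is used at [a./2]. *)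
rewrite expnS divnMA divn2 => /IH g_half.
(* The even summand [2 * 2 ^ k] keeps the parity of [a] and adds [2 ^ k] to its half; the factor 4
   of [gE] then supplies the square of the extra 2. *)
rewrite gE (gE a) mul2n halfD oddD odd_double andbF doubleK addbF g_half.
by rewrite -mul2n expnMn; lia.
Qed.

Theorem theorem2p1 (q a b : nat) (hq : exists k : nat, q = (2 ^ k)%N) :
  (~~ odd (a %/ q)%N -> 'X^(2 * q ^ 2)%N * brmon a b = brmon (a + q)%N b) /\
  (~~ odd (b %/ q)%N -> 'X^(4 * q ^ 2)%N * brmon a b = brmon a (b + q)%N).
Proof.
case: hq => k ->; split=> /g_addn_expn2 gD; rewrite /brmon -exprD gD;
  by congr ('X^_); lia.
Qed.
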